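(* Let $r_{12},r_{13},r_{23}$ be positive integers, $r_{ji}=r_{ij}$, let $\Pi(r_{12},r_{13},r_{23})$ be the Gale dual type-A root polytope, and set $r_i=\sum_{j\ne i}r_{ij}$ for $i=1,2,3$. Then the $h$-polynomial of $\Pi(r_{12},r_{13},r_{23})$ is equal to the Poincaré polynomial of the product of projective spaces $\mathbb P^{r_1-1}\times\mathbb P^{r_2-1}\times\mathbb P^{r_3-1}$: $$h(\Pi(r_{12},r_{13},r_{23}),t)=\prod_{i=1}^3(1+t+t^2+\dots+t^{r_i-1}).$$
   Context: **Polytope.** For $1\le i\ne j\le 3$ let $\alpha_{ij}=\varepsilon_i-\varepsilon_j$ in $\{x\in\mathbb R^3: x_1+x_2+x_3=0\}$. Let $\mathfrak A=[\alpha_1,\dots,\alpha_n]$ be the sequence in which each $\alpha_{ij}$ (for every ordered pair $i\neq j$) is repeated $r_{ij}$ times; $n=2(r_{12}+r_{13}+r_{23})$, $d=n-2$. Let $\mathfrak t$ be the dual of the $d$-dimensional space $\mathfrak t^*=\{m\in\mathbb R^n:\sum_i m_i\alpha_i=0\}$, and let $\beta_i\in\mathfrak t$ be the functional $m\mapsto m_i$ (the Gale dual sequence). $\Pi(r_{12},r_{13},r_{23})$ is the convex hull of $\beta_1,\dots,\beta_n$, a polytope of dimension $d-1$. The Poincaré polynomial here is taken in the variable $t$ of cohomological degree 2: $\sum_i\dim H^{2i}\,t^i$. **$g$- and $h$-polynomials (Stanley).** For convex polytopes define inductively: $g(\emptyset,t)=h(\emptyset,t)=1$, $\dim\emptyset=-1$;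 for a polytope $P$ of dimension $D\ge 0$, $$h(P,t)=\sum_{F<P}g(F,t)(t-1)^{D-1-\dim F},$$ the sum over all proper faces $F$ of $P$ including the empty face; writing $h(P,t)=\sum_{i=0}^D h_it^i$, set $g(P,t)=h_0+\sum_{i=1}^{\lfloor D/2\rfloor}(h_i-h_{i-1})t^i$. *)

(* Defs.v *)
From HB Require Import structures.
From mathcomp Require Import all_boot all_order all_algebra.
From mathcomp Require Import zify.
From mathcomp Require Import boolp classical_sets cardinality fsbigop.

Set Implicit Arguments.
Unset Strict Implicit.
Unset Printing Implicit Defensive.

Import Order.TTheory GRing.Theory Num.Theory.
Local Open Scope classical_set_scope.
Local Open Scope ring_scope.

Definition convex_hull (R : realFieldType) (V : lmodType R) (A : set V) :
    set V :=
  [set x | exists n (p : 'I_n -> V) (w : 'I_n -> R),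
     [/\ forall i, A (p i), forall i, 0 <= w i,
         \sum_i w i = 1 & x = \sum_i w i *: p i]].

Definition linear_span (R : realFieldType) (V : vectType R) (A : set V) :
    {vspace V} :=
  xget fullv [set U : {vspace V} | (forall x, A x -> x \in U) /\
    forall W : {vspace V}, (forall x, A x -> x \in W) -> (U <= W)%VS].

(* The dimension of the affine hull, which is a translate of the span of the
   differences of points of A. *)
Definition pdim (R : realFieldType) (V : vectType R) (A : set V) : int :=
  if A == set0 then -1
  else (\dim (linear_span [set z | exists2 x, A x & exists2 y, A y & z = x - y]))%:Z.

(* P itself and set0 are faces of P (take f = 0 and c = 0, resp. c = 1). *)
Definition is_face (R : realFieldType) (V : vectType R) (P F : set V) : Prop :=
  exists (f : 'Hom(V, R^o)) (c : R),
    (forall x, P x -> f x <= c) /\ F = [set x | P x /\ f x = c].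

Definition proper_faces (R : realFieldType) (V : vectType R) (P : set V) :
    set (set V) :=
  [set F | is_face P F /\ F <> P].

Definition g_of_h (D : nat) (h : {poly int}) : {poly int} :=
  h`_0 *: 1 + \sum_(1 <= i < (D./2).+1) (h`_i - h`_i.-1) *: 'X^i.

(* The recursion is on the dimension: k is a bound for dim P + 1. The arguments
   of the absolute values are nonnegative; h_polyE and g_polyE below are the
   defining equations without the bound k. A sum over an infinite support is 0,
   but a polytope has finitely many faces. *)
Fixpoint h_rec (R : realFieldType) (V : vectType R) (k : nat) (P : set V) :
    {poly int} :=
  if k is k'.+1 then
    if P == set0 then 1 else
    \sum_(F \in proper_faces P)
      (if F == set0 then 1 else g_of_h (absz (pdim F)) (h_rec k' F)) *
      ('X - 1) ^+ absz (pdim P - 1 - pdim F)%R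
  else 1.

Definition h_poly (R : realFieldType) (V : vectType R) (P : set V) :
    {poly int} :=
  h_rec (absz (pdim P + 1)) P.

Definition g_poly (R : realFieldType) (V : vectType R) (P : set V) :
    {poly int} :=
  if P == set0 then 1 else g_of_h (absz (pdim P)) (h_poly P).

Lemma linear_spanP (R : realFieldType) (V : vectType R) (A : set V) :
  (forall x, A x -> x \in linear_span A) /\
  (forall W : {vspace V}, (forall x, A x -> x \in W) -> (linear_span A <= W)%VS).
Proof.
rewrite /linear_span; set S := [set U : {vspace V} | _].
suff [U SU] : exists U, S U by exact: (@xgetPex _ fullv S (ex_intro _ U SU)).
pose Q k := `[< exists s : seq V, (forall x, x \in s -> A x) /\ \dim <<s>>%VS = k >].
have exQ : exists k, Q k.
  by exists (\dim <<[::] : seq V>>%VS); apply/asboolP; exists [::].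
have bQ k : Q k -> (k <= \dim {:V})%N.
  by move=> /asboolP[s [_ <-]]; apply/dimvS/subvf.
case: (ex_maxnP exQ bQ) => k /asboolP[s [sA dk]] maxk.
exists <<s>>%VS; split => [x Ax|W AW]; last first.
  by apply/span_subvP => x xs; apply/AW/sA.
have /maxk : Q (\dim <<x :: s>>%VS).
  apply/asboolP; exists (x :: s); split => // y.
  by rewrite inE => /orP[/eqP ->|/sA].
rewrite -dk => le_dim.
have sub : (<<s>> <= <<x :: s>>)%VS by rewrite span_cons addvSr.
have /eqP -> : (<<s>>%VS == <<x :: s>>%VS) by rewrite eqEdim sub.
by rewrite memv_span ?mem_head.
Qed.

Lemma pdim_set0 (R : realFieldType) (V : vectType R) : pdim (@set0 V) = -1.
Proof. by rewrite /pdim eqxx. Qed.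

Lemma pdim_ge0 (R : realFieldType) (V : vectType R) (P : set V) :
  P <> set0 -> 0 <= pdim P.
Proof. by move/eqP/negbTE => P0; rewrite /pdim P0. Qed.

Lemma pdim_proper_face (R : realFieldType) (V : vectType R) (P F : set V) :
  proper_faces P F -> pdim F < pdim P.
Proof.
move=> [[f [c [fP ->{F}]]] FP]; set F := [set x | _] in FP *.
have P0 : P <> set0.
  by move=> P0; apply: FP; rewrite /F P0; apply/seteqP; split => x //= [].
have [->|F0] := pselect (F = set0).
  by rewrite pdim_set0; apply: lt_le_trans (pdim_ge0 P0).
have [y Py fy] : exists2 y, P y & f y <> c.
  apply: contrapT => noy; apply: FP; apply/seteqP; split => [x []//|x Px].
  by split=> //; apply: contrapT => fx; apply: noy; exists x.
have [x [Px fx]] : exists x, F x.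
  by apply: contrapT => nox; apply: F0; apply/seteqP; split=> // z Fz; apply: nox; exists z.
rewrite /pdim; move/eqP/negbTE: F0 => ->; move/eqP/negbTE: P0 => ->.
set A := [set z | _]; set B := [set z | _].
have [BP _] := linear_spanP B; have [_ AS] := linear_spanP A.
have AB : (linear_span A <= linear_span B)%VS.
  apply: AS => z [u [Pu _] [v [Pv _] ->]].
  by apply: BP; exists u => //; exists v.
rewrite ltz_nat ltn_neqAle dimvS // andbT (eq_leqif (dimv_leqif_sup AB)).
apply/negP => sub.
have : (linear_span A <= lker f)%VS.
  by apply: AS => z [u [_ fu] [v [_ fv] ->]]; rewrite memv_ker raddfB /= fu fv subrr.
have Byx : y - x \in linear_span B by apply: BP; exists y => //; exists x.
move=> /(subv_trans sub)/subvP/(_ _ Byx).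
by rewrite memv_ker raddfB /= fx subr_eq0 => /eqP.
Qed.

Lemma h_rec_bound (R : realFieldType) (V : vectType R) k l (P : set V) :
  pdim P + 1 <= k%:Z -> pdim P + 1 <= l%:Z -> h_rec k P = h_rec l P.
Proof.
elim: k l P => [|k IHk] [|l] P Pk Pl //=.
- by case: eqP => // /pdim_ge0; lia.
- by case: eqP => // /pdim_ge0; lia.
- case: eqP => // P0; apply: eq_fsbigr => F /set_mem /pdim_proper_face dF.
  by rewrite (IHk l) //; lia.
Qed.

Lemma h_poly_set0 (R : realFieldType) (V : vectType R) : h_poly (@set0 V) = 1.
Proof. by rewrite /h_poly pdim_set0. Qed.

Lemma g_poly_set0 (R : realFieldType) (V : vectType R) : g_poly (@set0 V) = 1.
Proof. by rewrite /g_poly eqxx. Qed.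

Lemma h_polyE (R : realFieldType) (V : vectType R) (P : set V) :
  P <> set0 ->
  h_poly P = \sum_(F \in proper_faces P)
    g_poly F * ('X - 1) ^+ absz (pdim P - 1 - pdim F)%R.
Proof.
move=> P0; have Pge := pdim_ge0 P0; rewrite /h_poly.
have -> : absz (pdim P + 1)%R = (absz (pdim P)).+1 by lia.
rewrite /=; case: eqP => // _.
apply: eq_fsbigr => F /set_mem /pdim_proper_face dF.
rewrite /g_poly; case: eqP => // /pdim_ge0 F0.
by rewrite /h_poly (@h_rec_bound _ _ (absz (pdim P)) (absz (pdim F + 1)%R)) //; lia.
Qed.

Lemma g_polyE (R : realFieldType) (V : vectType R) (P : set V) (D : nat) :
  pdim P = D%:Z ->
  g_poly P = (h_poly P)`_0 *: 1 +
    \sum_(1 <= i < (D./2).+1) ((h_poly P)`_i - (h_poly P)`_i.-1) *: 'X^i.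
Proof.
move=> dP; rewrite /g_poly dP; case: eqP => // P0.
by move: dP; rewrite P0 pdim_set0.
Qed.

(* For a sequence s of vectors of W, the space t^* of linear relations
   \sum_i m_i s_i = 0, its dual t, and the coordinate functionals beta_i. *)
Definition relation_map (R : realFieldType) (W : vectType R) (s : seq W)
    (m : 'rV[R]_(size s)) : W :=
  \sum_(i < size s) m 0 i *: s`_i.

Fact relation_map_is_linear (R : realFieldType) (W : vectType R) (s : seq W) :
  linear (@relation_map R W s).
Proof.
move=> a u v; rewrite /relation_map scaler_sumr -big_split /=.
by apply: eq_bigr => i _; rewrite !mxE scalerDl scalerA.
Qed.

HB.instance Definition _ (R : realFieldType) (W : vectType R) (s : seq W) :=
  GRing.isLinear.Build R _ _ _ (@relation_map R W s)
    (@relation_map_is_linear R W s).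

Definition relation_space (R : realFieldType) (W : vectType R) (s : seq W) :
    {vspace 'rV[R]_(size s)} :=
  lker (linfun (@relation_map R W s)).

Definition gale_space (R : realFieldType) (W : vectType R) (s : seq W) :
    vectType R :=
  'Hom(subvs_of (relation_space s), R^o).

Definition coordinate (R : realFieldType) (W : vectType R) (s : seq W)
    (i : 'I_(size s)) (m : subvs_of (relation_space s)) : R^o :=
  vsval m 0 i.

Fact coordinate_is_linear (R : realFieldType) (W : vectType R) (s : seq W)
    (i : 'I_(size s)) :
  linear (coordinate i).
Proof. by move=> a u v; rewrite /coordinate linearP /= !mxE. Qed.

HB.instance Definition _ (R : realFieldType) (W : vectType R) (s : seq W)
    (i : 'I_(size s)) :=
  GRing.isLinear.Build R _ _ _ (@coordinate R W s i)
    (@coordinate_is_linear R W s i).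

Definition gale_dual (R : realFieldType) (W : vectType R) (s : seq W)
    (i : 'I_(size s)) : gale_space s :=
  linfun (coordinate i).

Lemma mem_relation_space (R : realFieldType) (W : vectType R) (s : seq W)
    (m : 'rV[R]_(size s)) :
  (m \in relation_space s) = (\sum_(i < size s) m 0 i *: s`_i == 0).
Proof. by rewrite memv_ker lfunE. Qed.

Lemma gale_dualE (R : realFieldType) (W : vectType R) (s : seq W)
    (i : 'I_(size s)) (m : subvs_of (relation_space s)) :
  (gale_dual i : 'Hom(_, _)) m = vsval m 0 i.
Proof. by rewrite lfunE. Qed.

(* The roots lie in the plane x_1 + x_2 + x_3 = 0 of 'rV_3; the space of
   relations does not depend on which of the two spaces contains them. *)
Definition typeA_root (R : realFieldType) (i j : 'I_3) : 'rV[R]_3 :=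
  delta_mx 0 i - delta_mx 0 j.

(* The values of r on the diagonal are not used. *)
Definition typeA_roots (R : realFieldType) (r : 'I_3 -> 'I_3 -> nat) :
    seq 'rV[R]_3 :=
  flatten [seq nseq (r ij.1 ij.2) (typeA_root R ij.1 ij.2)
          | ij <- enum {: 'I_3 * 'I_3} & ij.1 != ij.2].

Definition gale_root_polytope (R : realFieldType) (r : 'I_3 -> 'I_3 -> nat) :
    set (gale_space (typeA_roots R r)) :=
  convex_hull (range (@gale_dual R _ (typeA_roots R r))).
Arguments gale_root_polytope : clear implicits.

(* Main.v *)
Require Import Defs.
From HB Require Import structures.
From mathcomp Require Import all_boot all_order all_algebra.
From mathcomp Require Import boolp classical_sets cardinality fsbigop reals.
From mathcomp Require Import zify ring lra.

(* By Gale duality the nonempty faces of the polytope, together with the empty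
   one, are the hulls F_J of the beta_i with i outside J, where J runs over the
   supports of the nonnegative relations among the roots.  For type A_2 a
   relation is a circulation on a digraph with three vertices, so J is such a
   support iff every arc of J lies on a directed 2- or 3-cycle: J is empty, or a
   digon on two vertices, or strongly connected on all three.  In the last case
   F_J is a simplex, with g = 1; for a digon avoiding the vertex c one has
   h(F_J) = [p][z + p], where [m] = 1 + ... + t^(m-1), p = r_c and z + 2p is the
   number of the beta_i in F_J, so that g(F_J) = [p].  Multiplied by a
   power of t - 1 the defining recursion of h becomes a sum of
   (t - 1)^|K| over subsets K, which depends on K only through the set of arcs
   it uses; for J empty it evaluates to the product of the t^(r_i) - 1. *)

Set Implicit Arguments.
Unset Strict Implicit.
Unset Printing Implicit Defensive.

Import Order.TTheory GRing.Theory Num.Theory.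
Local Open Scope ring_scope.

(** * Faces of convex hulls *)

Section ConvexHull.
Variables (R : realFieldType) (V : vectType R).
Implicit Types (A : set V) (f : 'Hom(V, R^o)).
Local Open Scope classical_set_scope.

Lemma sub_convex_hull A : A `<=` convex_hull A.
Proof.
move=> x Ax; exists 1%N, (fun=> x), (fun=> 1); split=> //.
- by rewrite big_ord1.
- by rewrite big_ord1 scale1r.
Qed.

Lemma convex_hullS A B : A `<=` B -> convex_hull A `<=` convex_hull B.
Proof.
by move=> AB x [k [p [w [Ap w0 w1 ->]]]]; exists k, p, w; split=> // i; apply: AB.
Qed.

Lemma convex_hull_set0 : convex_hull (@set0 V) = set0.
Proof.
apply/seteqP; split=> // x [[|k] [p [w [Ap w0 w1 _]]]].
  by move: w1; rewrite big_ord0 => /esym/eqP; rewrite oner_eq0.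
exact: (Ap ord0).
Qed.

Lemma convex_hull_le A f c : (forall x, A x -> f x <= c) ->
  forall x, convex_hull A x -> f x <= c.
Proof.
move=> Ac x [k [p [w [Ap w0 w1 ->]]]].
rewrite linear_sum /= -[c]mul1r -w1 mulr_suml.
by apply: ler_sum => i _; rewrite linearZ; apply: ler_wpM2l => //; apply: Ac.
Qed.

(** If f attains the bound c at a convex combination, the nonnegative terms w_i (c - f(p_i)) sum to
    0, so every point of nonzero weight already satisfies f = c. *)
Lemma convex_hull_face A f c : (forall x, A x -> f x <= c) ->
  [set x | convex_hull A x /\ f x = c] = convex_hull [set x | A x /\ f x = c].
Proof.
move=> Ac; apply/seteqP; split=> x; last first.
  move=> Hx; split; first by apply: convex_hullS Hx => y [].
  move: Hx => [k [p [w [Ap w0 w1 ->]]]].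
  rewrite linear_sum /= -[RHS]mul1r -w1 mulr_suml.
  by apply: eq_bigr => i _; rewrite linearZ /= (Ap i).2.
move=> [[k [p [w [Ap w0 w1 ->]]]]].
rewrite linear_sum /= => fx.
have tight i : w i != 0 -> f (p i) = c.
  have /eqP : \sum_i w i * (c - f (p i)) = 0.
    under eq_bigr do rewrite mulrBr.
    rewrite sumrB -mulr_suml w1 mul1r -fx.
    by apply/eqP; rewrite subr_eq0; apply/eqP/eq_bigr => j _; rewrite linearZ.
  rewrite psumr_eq0; last by move=> j _; rewrite mulr_ge0 ?subr_ge0 ?Ac.
  move=> /allP/(_ i); rewrite mem_index_enum => /(_ isT)/=.
  by rewrite mulf_eq0 => /orP[->//|]; rewrite subr_eq0 => /eqP <-.
have [j wj] : exists j, w j != 0.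
  apply: contrapT => no; move: w1; rewrite big1 => [|j _].
    by move=> /esym/eqP; rewrite oner_eq0.
  by apply: contrapT => /eqP wj; apply: no; exists j.
(* Points of weight 0 need not be tight; they are replaced by the tight point [p j]. *)
exists k, (fun i => if w i == 0 then p j else p i), w; split=> //.
- by move=> i; case: ifPn => [_|wi]; split=> //; apply: tight.
- by apply: eq_bigr => i _; case: ifPn => // /eqP ->; rewrite !scale0r.
Qed.

End ConvexHull.

(** Expanding x in the coordinate functionals of a basis forces the i-th coordinate of u to be the
    value of f at the i-th coordinate functional. *)
Lemma double_dual (R : realFieldType) (U : vectType R)
    (f : 'Hom('Hom(U, R^o), R^o)) :
  exists u : U, forall x : 'Hom(U, R^o), f x = x u.
Proof.
pose e := vbasis (fullv : {vspace U}).
exists (\sum_(i < \dim {:U}) f (linfun (coord e i : U -> R^o)) *: e`_i) => x.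
have {1}-> : x = \sum_(i < \dim {:U}) (x e`_i) *: linfun (coord e i : U -> R^o).
  apply/lfunP => u; rewrite {1}(coord_vbasis (memvf u)) linear_sum sum_lfunE.
  by apply: eq_bigr => i _; rewrite linearZ scale_lfunE lfunE; apply: mulrC.
rewrite !linear_sum; apply: eq_bigr => i _.
rewrite [LHS]linearZ [RHS]linearZ; exact: mulrC.
Qed.

(** * Faces of the Gale dual polytope and positive relations *)

Section GaleFaces.
Variables (R : realFieldType) (W : vectType R) (s : seq W).
Hypothesis s_sum0 : \sum_(i < size s) s`_i = 0.
Implicit Types (J : {set 'I_(size s)}) (m : 'rV[R]_(size s)).
Local Open Scope classical_set_scope.

(** Indexed by the generators left out, because J is then the support of a relation cutting out the
    face; larger J give smaller faces. *)
Definition gale_face J : set (gale_space s) :=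
  convex_hull [set x | exists2 i, i \notin J & x = gale_dual i].

Definition positive_relation J m :=
  [/\ m \in relation_space s, forall i, 0 <= m 0 i
    & forall i, (m 0 i != 0) = (i \in J)].

Definition positive_support J := exists m, positive_relation J m.

(** For c = 1 this yields a functional equal to 1 on every beta_i, so the polytope lies in an affine
    hyperplane missing the origin. For general c it absorbs the level of a supporting functional
    into a relation. *)
Lemma const_relation c : const_mx c \in relation_space s.
Proof.
rewrite mem_relation_space; apply/eqP.
under eq_bigr do rewrite mxE.
by rewrite -scaler_sumr s_sum0 scaler0.
Qed.

Lemma gale_functional (f : 'Hom(gale_space s, R^o)) :
  exists2 m, m \in relation_space s & forall i, f (gale_dual i) = m 0 i.
Proof.
have [u fu] := double_dual f.
by exists (vsval u) => [|i]; [exact: subvsP | rewrite fu gale_dualE].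
Qed.

Definition evaluation (u : subvs_of (relation_space s)) (x : gale_space s) : R^o :=
  (x : 'Hom(_, _)) u.

Fact evaluation_is_linear u : linear (evaluation u).
Proof. by move=> a x y; rewrite /evaluation add_lfunE scale_lfunE. Qed.

HB.instance Definition _ u :=
  GRing.isLinear.Build R _ _ _ (evaluation u) (evaluation_is_linear u).

Lemma relation_eval m : m \in relation_space s ->
  exists f : 'Hom(gale_space s, R^o), forall i, f (gale_dual i) = m 0 i.
Proof.
move=> ms; exists (linfun (evaluation (vsproj (relation_space s) m))) => i.
by rewrite lfunE /= /evaluation gale_dualE vsprojK.
Qed.

Lemma gale_face_level J (f : 'Hom(gale_space s, R^o)) c :
  (forall x, gale_face J x -> f x <= c) ->
  [set x | gale_face J x /\ f x = c] =
  gale_face (J :|: [set i | f (gale_dual i) != c]%SET).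
Proof.
move=> fc; rewrite convex_hull_face => [|x Ax]; last by apply/fc/sub_convex_hull.
congr convex_hull; apply/seteqP; split=> x.
  by move=> [[i iJ ->] fi]; exists i; rewrite // !inE (negbTE iJ) fi eqxx.
move=> [i]; rewrite !inE negb_or negbK => /andP[iJ /eqP fi] ->.
by split=> //; exists i.
Qed.

(** A nonnegative relation with support J, seen as a functional, vanishes on the whole face but is
    positive at beta_i for i in J. *)
Lemma gale_dual_face J i : positive_support J ->
  gale_face J (gale_dual i) <-> i \notin J.
Proof.
move=> [m [ms m0 mJ]]; split; last by move=> iJ; apply: sub_convex_hull; exists i.
have [f fE] := relation_eval ms.
move/(@convex_hull_le _ _ _ f 0); rewrite fE -mJ negbK => m_le0.
by rewrite eq_le m0 m_le0 // => x [j jJ ->]; move: jJ; rewrite fE -mJ negbK => /eqP ->.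
Qed.

Lemma gale_face_inj J J' : positive_support J -> positive_support J' ->
  gale_face J = gale_face J' -> J = J'.
Proof.
move=> pJ pJ' eF; apply/setP => i; apply: negb_inj; apply/idP/idP.
  by move/(gale_dual_face i pJ); rewrite eF => /(gale_dual_face i pJ').
by move/(gale_dual_face i pJ'); rewrite -eF => /(gale_dual_face i pJ).
Qed.

(* A functional that is maximal on a face is a relation v with v_i <= c for i
   outside J; adding a large multiple of a relation supported on J to c - v
   makes it nonnegative. *)
Lemma face_of_gale_face J G : positive_support J ->
  is_face (gale_face J) G <->
  exists J', [/\ positive_support J', J \subset J' & G = gale_face J'].
Proof.
move=> [m [ms m0 mJ]]; split.
  move=> [f [c [fc ->]]]; rewrite (gale_face_level fc).
  have [v vs fv] := gale_functional f.
  exists (J :|: [set i | f (gale_dual i) != c]%SET); split=> //; last exact: finset.subsetUl.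
  have out i : i \notin J -> v 0 i <= c.
    by move=> iJ; rewrite -fv; apply/fc/sub_convex_hull; exists i.
  pose N := \sum_i `|c - v 0 i| / m 0 i + 1.
  have big i : i \in J -> 0 < c - v 0 i + N * m 0 i.
    rewrite -mJ => mi; have mi_gt0 : 0 < m 0 i by rewrite lt_def mi m0.
    have : `|c - v 0 i| / m 0 i < N.
      rewrite /N (bigD1 i) //= -addrA ltrDl ltr_wpDl //.
      by apply: sumr_ge0 => j _; rewrite divr_ge0.
    rewrite ltr_pdivrMr // => lt_N.
    have := ler_norm (- (c - v 0 i)); rewrite normrN; lra.
  exists (const_mx c - v + N *: m); split.
  - by rewrite rpredD ?rpredZ // rpredB // const_relation.
  - move=> i; rewrite !mxE; have [iJ|iJ] := boolP (i \in J); first exact/ltW/big.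
    have := mJ i; rewrite (negbTE iJ) => /negbFE/eqP ->.
    by rewrite mulr0 addr0 subr_ge0 out.
  - move=> i; rewrite !mxE !inE fv; have [iJ|iJ] := boolP (i \in J).
      by rewrite gt_eqF ?big.
    have := mJ i; rewrite (negbTE iJ) => /negbFE/eqP ->.
    by rewrite mulr0 addr0 subr_eq0 eq_sym.
move=> [J' [[m' [ms' m0' mJ']] JJ' ->]].
have [f fE] := relation_eval ms'.
have fle x : gale_face J x -> (- f) x <= 0.
  apply: convex_hull_le => y [i iJ ->].
  by rewrite opp_lfunE fE oppr_le0.
exists (- f), 0; split=> //; rewrite (gale_face_level fle); congr gale_face.
apply/setP => i; rewrite !inE opp_lfunE fE oppr_eq0 mJ'.
by apply/idP/orP => [|[/(fintype.subsetP JJ')|]//]; right.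
Qed.

Lemma gale_face_setT : gale_face [set: 'I_(size s)]%SET = set0.
Proof.
rewrite /gale_face -(convex_hull_set0 (gale_space s)); congr convex_hull.
by apply/seteqP; split=> // x [i]; rewrite inE.
Qed.

Lemma gale_face_neq0 J : J != [set: 'I_(size s)]%SET -> gale_face J <> set0.
Proof.
rewrite finset.eqEsubset finset.subsetT /= => /fintype.subsetPn[i _ iJ] F0.
have : gale_face J (gale_dual i) by apply: sub_convex_hull; exists i.
by rewrite F0.
Qed.

(** By [gale_face_inj] the proper faces correspond bijectively to the positive supports strictly
    containing J, the full index set giving the empty face. *)
Lemma h_poly_gale_face J : positive_support J -> J != [set: 'I_(size s)]%SET ->
  h_poly (gale_face J) =
  \sum_(J' : {set 'I_(size s)} | `[< positive_support J' >] && (J \proper J'))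
    g_poly (gale_face J') *
    ('X - 1) ^+ absz (pdim (gale_face J) - 1 - pdim (gale_face J'))%R.
Proof.
move=> pJ JT; rewrite h_polyE; last exact: gale_face_neq0.
have -> : proper_faces (gale_face J) =
  gale_face @` [set J' | positive_support J' /\ J \proper J'].
  apply/seteqP; split=> G.
    move=> [/(face_of_gale_face _ pJ)[J' [pJ' JJ' ->]] neq].
    exists J' => //; split=> //; rewrite finset.properEneq JJ' andbT.
    by apply/eqP => eJ; apply: neq; rewrite eJ.
  move=> [J' [pJ' JJ'] <-]; split.
    by apply/(face_of_gale_face _ pJ); exists J'; rewrite fintype.proper_sub.
  move=> /(gale_face_inj pJ' pJ) eJ.
  by move: JJ'; rewrite eJ fintype.properxx.
rewrite fsbig_image; last first.
  by move=> x y /set_mem[px _] /set_mem[py _]; apply: gale_face_inj.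
pose Q := [pred J' | `[< positive_support J' >] && (J \proper J')].
rewrite (_ : mkset _ = [set` fintype.enum Q]); last first.
  apply/seteqP; split=> J' /=; rewrite mem_enum inE.
    by move=> [pJ' JJ']; rewrite asboolT.
  by move=> /andP[/asboolP].
by rewrite -fsbig_seq ?enum_uniq // big_enum.
Qed.

End GaleFaces.

(** * Dimension of a face from a basis of the vectors *)

(* The complement of a basis B of s indexes a basis of the Gale dual space.  If
   B contains a basis of the span of the s_j, j in J, then the beta_i with i
   outside J and B form a basis of the span of the face. *)
Section GaleDimension.
Variables (R : realFieldType) (W : vectType R) (s : seq W).
Hypothesis s_sum0 : \sum_(i < size s) s`_i = 0.
Variables (J B : {set 'I_(size s)}) (a : 'I_(size s) -> 'I_(size s) -> R).
Hypothesis B_span : forall i : 'I_(size s), s`_i = \sum_(b in B) a i b *: s`_b.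
Hypothesis B_free : forall c : 'I_(size s) -> R,
  \sum_(b in B) c b *: s`_b = 0 -> forall b, b \in B -> c b = 0.
Hypothesis a_J : forall i b, i \in J -> b \in B -> b \notin J -> a i b = 0.

Let D : {set 'I_(size s)} := ~: (J :|: B).
Let X := [tuple gale_dual (enum_val i) | i < #|D|].

Let in_D i : (i \in D) = (i \notin J) && (i \notin B).
Proof. by rewrite !inE negb_or. Qed.

(** The analogue of a fundamental cycle. For i outside B its only nonzero coordinate outside B is
    the i-th, so these relations are dual to the beta_i with i in D. *)
Let fundamental_relation (i : 'I_(size s)) : 'rV[R]_(size s) :=
  \row_j ((j == i)%:R - (if j \in B then a i j else 0)).

Let fundamental_relationP i : fundamental_relation i \in relation_space s.
Proof.
rewrite mem_relation_space; apply/eqP.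
under eq_bigr do rewrite mxE scalerBl.
rewrite sumrB (bigD1 i) //= eqxx scale1r big1 => [|j /negbTE ->]; last exact: scale0r.
rewrite addr0 [X in X - _]B_span big_mkcond /= -sumrB big1 // => j _.
by case: ifP; rewrite ?scale0r subrr.
Qed.

Lemma cobasis_free : free X.
Proof.
apply/freeP => k kX j.
have Xi (i : 'I_#|D|) : X`_i = gale_dual (enum_val i) by rewrite -tnth_nth tnth_mktuple.
have /lfunP/(_ (vsproj (relation_space s) (fundamental_relation (enum_val j)))) := kX.
rewrite sum_lfunE zero_lfunE (bigD1 j) //= big1 => [|i ij].
  rewrite addr0 scale_lfunE Xi gale_dualE vsprojK ?fundamental_relationP // mxE eqxx.
  have := enum_valP j; rewrite in_D => /andP[_ /negbTE ->].
  by rewrite subr0; rewrite [LHS]mulr1.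
rewrite scale_lfunE Xi gale_dualE vsprojK ?fundamental_relationP // mxE.
have := enum_valP i; rewrite in_D => /andP[_ /negbTE ->].
by rewrite (inj_eq enum_val_inj) (negbTE ij) subr0; rewrite [LHS]mulr0.
Qed.

(** Expand a relation m over B. For i in B, the coefficient of s_i is m_i plus the sum of m_j a_ji
    over j outside B; by [a_J] the terms with j in J drop out, which expresses beta_i through D. *)
Lemma gale_dual_cobasis i : i \notin J -> (gale_dual i \in <<X>>)%VS.
Proof.
move=> iJ.
have D_X j : j \in D -> (gale_dual j \in <<X>>)%VS.
  move=> jD; apply: memv_span; apply/tnthP; exists (enum_rank_in jD j).
  by rewrite tnth_mktuple enum_rankK_in.
have [iB|iB] := boolP (i \in B); last by apply: D_X; rewrite in_D iJ.
suff -> : gale_dual i = - \sum_(j in D) a j i *: gale_dual j.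
  by rewrite memvN; apply: memv_suml => j jD; apply/memvZ/D_X.
apply/lfunP => u; rewrite opp_lfunE sum_lfunE gale_dualE.
have := subvsP u; rewrite mem_relation_space => /eqP.
set m := vsval u => m_rel.
have m_i : \sum_j m 0 j * a j i = 0.
  apply: (B_free (c := fun b => \sum_j m 0 j * a j b)) => //.
  under eq_bigr do rewrite scaler_suml.
  rewrite exchange_big /= -[RHS]m_rel; apply: eq_bigr => j _.
  by rewrite [in RHS]B_span scaler_sumr; apply: eq_bigr => b _; rewrite scalerA.
have a_B b c : b \in B -> c \in B -> a b c = (b == c)%:R.
  move=> bB cB; apply/eqP; rewrite eq_sym -subr_eq0; apply/eqP.
  apply: (B_free (c := fun c => (b == c)%:R - a b c)) => //.
  under eq_bigr do rewrite scalerBl.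
  rewrite sumrB -B_span (bigD1 b) //= eqxx scale1r big1 ?addr0 ?subrr //.
  by move=> d /andP[_ db]; rewrite eq_sym (negbTE db) scale0r.
move: m_i; rewrite (bigID [in D]) /= [X in _ + X](bigD1 i) ?in_D ?iB ?andbF //=.
rewrite [X in _ + (_ + X)]big1 ?addr0.
  rewrite a_B // eqxx mulr1 addrC => /eqP; rewrite addr_eq0 => /eqP ->.
  congr (- _); apply: eq_bigr => j _; rewrite scale_lfunE gale_dualE -/m.
  exact: mulrC.
move=> j /andP[]; rewrite in_D negb_and !negbK => jD ji.
have [jB|jB] := boolP (j \in B); first by rewrite a_B // (negbTE ji) mulr0.
by rewrite a_J ?mulr0 //; move: jD; rewrite (negbTE jB) orbF.
Qed.

(** The functional equal to 1 on every beta_i vanishes on differences, so for a nonempty face the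
    span of X is the direct sum of the direction space and the line of one beta_i. The dimension is
    therefore #|D| - 1, which is -1 for the empty face too. *)
Lemma pdim_gale_face :
  pdim (gale_face J) = (size s)%:Z - #|J :|: B|%:Z - 1.
Proof.
have cD : (#|D| + #|J :|: B| = size s)%N by rewrite addnC cardsC card_ord.
have [JT|JT] := eqVneq J [set: 'I_(size s)].
  rewrite JT gale_face_setT pdim_set0 finset.setTU cardsT card_ord; lia.
have /eqP/negbTE F0 := gale_face_neq0 JT.
rewrite /pdim F0; set L := linear_span _.
move: (JT); rewrite finset.eqEsubset finset.subsetT /= => /fintype.subsetPn[i0 _ i0J].
have hull_X x : gale_face J x -> (x \in <<X>>)%VS.
  move=> [k [p [w [Ap _ _ ->]]]]; apply: memv_suml => i _; apply: memvZ.
  by have [j jJ ->] := Ap i; apply: gale_dual_cobasis.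
have [f fE] := relation_eval (const_relation s_sum0 1).
have f1 x : gale_face J x -> f x = 1.
  move=> [k [p [w [Ap _ w1 ->]]]]; rewrite -w1 linear_sum.
  apply: eq_bigr => i _; have [j _ ->] := Ap i.
  by rewrite linearZ /= fE mxE [LHS]mulr1.
have face_i i : i \notin J -> gale_face J (gale_dual i).
  by move=> iJ; apply: sub_convex_hull; exists i.
have [subL leL] := linear_spanP
  [set z | exists2 x, gale_face J x & exists2 y, gale_face J y & z = x - y]%classic.
have LX : (L + <[gale_dual i0]> = <<X>>)%VS.
  apply/eqP; rewrite eqEsubv; apply/andP; split.
    rewrite subv_add -memvE (hull_X _ (face_i _ i0J)) andbT.
    by apply: leL => z [x Fx [y Fy ->]]; rewrite memvB ?hull_X.
  apply/span_subvP => x /tnthP[i ->]; rewrite tnth_mktuple.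
  have := enum_valP i; rewrite in_D => /andP[iJ _].
  rewrite -[gale_dual _](subrK (gale_dual i0)) memv_add ?memv_line //.
  apply: subL; exists (gale_dual (enum_val i)); first exact: face_i.
  by exists (gale_dual i0); first exact: face_i.
have L0 : (L :&: <[gale_dual i0]> = 0)%VS.
  apply/eqP; rewrite -subv0; apply/subvP => v; rewrite memv_cap => /andP[vL].
  move=> /vlineP[c vc]; rewrite memv0 vc.
  have : (L <= lker f)%VS.
    by apply: leL => z [x Fx [y Fy ->]]; rewrite memv_ker linearB /= !f1 ?subrr.
  move=> /subvP/(_ _ vL); rewrite memv_ker vc linearZ /= (f1 _ (face_i _ i0J)).
  by rewrite [X in X == _]mulr1 => /eqP ->; rewrite scale0r.
have g0 : gale_dual i0 != 0.
  apply/eqP => g0; have := f1 _ (face_i _ i0J).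
  by rewrite g0 linear0 => /esym/eqP; rewrite oner_eq0.
have := dimv_disjoint_sum L0; rewrite LX dim_vline g0.
have /eqP -> : \dim <<X>>%VS == size X by exact: cobasis_free.
rewrite size_tuple /= => dL; move: cD; rewrite dL.
move=> sz; have <- : (\dim L + 1 + #|J :|: B|)%N%:Z = (size s)%:Z by rewrite sz.
by rewrite !PoszD; ring.
Qed.

End GaleDimension.

(** * Computing g from h by truncation *)

Lemma g_of_hE D (h : {poly int}) :
  g_of_h D h = take_poly (D./2).+1 ((1 - 'X) * h).
Proof.
apply/polyP => k; rewrite coef_take_poly /g_of_h coefD coefZ coef1 coef_sum.
rewrite mulrBl mul1r coefB coefXM.
under eq_bigr do rewrite coefZ coefXn.
case: k => [|k] /=.
  rewrite mulr1 subr0 big_nat big1 ?addr0 // => i /andP[i_gt0 _].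
  by rewrite ltn_eqF // mulr0.
rewrite mulr0 add0r; case: ltnP => Dk.
  rewrite (bigD1_seq k.+1) ?iota_uniq ?mem_index_iota //= eqxx mulr1.
  by rewrite big1 ?addr0 // => i /negbTE ik; rewrite eq_sym ik mulr0.
rewrite big_nat big1 // => i /andP[_ iD].
by rewrite gtn_eqF ?mulr0 // (leq_trans iD).
Qed.

Lemma g_of_h_uniq D (h p q : {poly int}) :
  (1 - 'X) * h = p + q * 'X^((D./2).+1) -> (size p <= (D./2).+1)%N -> g_of_h D h = p.
Proof. by move=> hE szp; rewrite g_of_hE hE take_polyDMXn. Qed.

Definition geom_sum n : {poly int} := \sum_(i < n) 'X^i.

Lemma size_geom_sum n : (size (geom_sum n) <= n)%N.
Proof.
apply: (leq_trans (size_sum _ _ _)); apply/bigmax_leqP => i _.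
by rewrite size_polyXn.
Qed.

Lemma geom_sumE n : 'X^n - 1 = ('X - 1) * geom_sum n :> {poly int}.
Proof. exact: subrX1. Qed.

Lemma X1_neq0 : ('X - 1 : {poly int}) != 0.
Proof. by rewrite -[1]/(1%:P) polyXsubC_eq0. Qed.

(** Here (1 - t) h = 1 - t^(D+1), and the truncation keeps the 1. *)
Lemma g_of_h_simplex D (h : {poly int}) :
  h * ('X - 1) + 1 = 'X^(D.+1) -> g_of_h D h = 1.
Proof.
move=> hE; apply: (@g_of_h_uniq _ _ _ (- 'X^(D.+1 - (D./2).+1))).
  rewrite mulNr -exprD subnK -?hE; last by lia.
  by ring.
by rewrite size_poly1.
Qed.

(** Here h = [p][z + p], so (1 - t) h = [p] - t^(z+p) [p]. From D + 2 = z + 2p, with D/2 rounded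
    down, p <= D/2 + 1 <= z + p, so the truncation keeps exactly [p]. *)
Lemma g_of_h_simplex_sum p z D (h : {poly int}) : (0 < p)%N -> D.+2 = (z + p + p)%N ->
  h * ('X - 1) ^+ 2 + ('X^p - 1) = 'X^z * 'X^p * ('X^p - 1) ->
  g_of_h D h = geom_sum p.
Proof.
move=> p_gt0 DE hE.
have hE' : ('X - 1) * h = geom_sum p * ('X^(z + p) - 1).
  apply: (mulfI X1_neq0); rewrite [RHS]mulrA -geom_sumE.
  apply: (addIr ('X^p - 1)); rewrite exprD.
  transitivity (h * ('X - 1) ^+ 2 + ('X^p - 1)); first by ring.
  by rewrite hE; ring.
apply: (@g_of_h_uniq _ _ _ (- (geom_sum p * 'X^(z + p - (D./2).+1)))).
  rewrite mulNr -mulrA -exprD subnK; last by lia.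
  by rewrite -opprB mulNr hE'; ring.
by apply: (leq_trans (size_geom_sum p)); lia.
Qed.

(** * Sums over subsets of a coloured set *)

Section SubsetSums.
Variables (I : finType) (A : comRingType).
Implicit Types (B C K : {set I}).

Lemma sum_subset_split B C (F : {set I} -> A) :
  \sum_(K : {set I} | K \subset B) F K =
  \sum_(K1 : {set I} | K1 \subset B :&: C)
    \sum_(K2 : {set I} | K2 \subset B :\: C) F (K1 :|: K2).
Proof.
rewrite pair_big_dep (reindex_onto (fun u => u.1 :|: u.2)
  (fun K => (K :&: C, K :\: C))) /=; last by move=> K _; rewrite finset.setID.
apply: eq_bigl => -[K1 K2] /=; apply/idP/idP.
  move=> /andP[KB /eqP[e1 e2]]; apply/andP; split.
    by rewrite -e1 finset.setSI.
  by rewrite -e2 finset.setSD.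
rewrite !finset.subsetI !finset.subsetD => /andP[/andP[K1B K1C] /andP[K2B K2C]].
rewrite finset.subUset K1B K2B /= finset.setIUl finset.setDUl.
rewrite (finset.setIidPl K1C) (finset.setDidPl K2C).
move: (K2C); rewrite -setI_eq0 => /eqP ->; rewrite finset.setU0.
by move: (K1C); rewrite -finset.setD_eq0 => /eqP ->; rewrite finset.set0U.
Qed.

Lemma sum_subset_pow B (x : A) :
  \sum_(K : {set I} | K \subset B) x ^+ #|K| = (1 + x) ^+ #|B|.
Proof.
rewrite -[RHS]prodr_const [RHS]big_mkcond /=.
rewrite [RHS](eq_bigr (fun i => (if i \in B then x else 0) + 1)); last first.
  by move=> i _; case: ifP; rewrite ?add0r // addrC.
rewrite bigA_distr [LHS]big_mkcond /=; apply: eq_bigr => K _.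
rewrite -big_mkcond /=; case: ifPn => [/fintype.subsetP KB|/fintype.subsetPn[i iK iB]].
  by rewrite -prodr_const; apply: eq_bigr => i /KB ->.
by rewrite (bigD1 i) //= (negbTE iB) mul0r.
Qed.

End SubsetSums.

Lemma sum_by_colour (I : finType) (T : eqType) (V : nmodType) (col : I -> T)
    (B : {set I}) (L : seq T) (f : T -> V) :
    uniq L -> (forall i, i \in B -> col i \in L) ->
  \sum_(i in B) f (col i) = \sum_(d <- L) f d *+ #|[set i in B | col i == d]%SET|.
Proof.
move=> uL BL.
under [RHS]eq_bigr => d _.
  rewrite -sumr_const (eq_bigl (fun i => (i \in B) && (col i == d))); last first.
    by move=> i; rewrite !inE.
  rewrite big_mkcondr /=; over.
rewrite exchange_big /=; apply: eq_bigr => i iB.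
rewrite -big_mkcond /= (eq_bigl (pred1 (col i))); last by move=> d; rewrite eq_sym.
by rewrite -big_filter filter_pred1_uniq ?BL // big_seq1.
Qed.

Section ColouredSubsetSums.
Variables (I : finType) (T : eqType) (A : comRingType) (col : I -> T) (x : A).
Implicit Types (B K : {set I}) (L acc : seq T).

(* The sum over subsets S of L of Phi (S \cup acc) * \prod_(d in S) w d, in a
   form that unfolds by computation. *)
Fixpoint weighted_sum (w : T -> A) (Phi : (T -> bool) -> A) L acc : A :=
  if L is d :: L' then
    weighted_sum w Phi L' acc + w d * weighted_sum w Phi L' (d :: acc)
  else Phi (fun d => d \in acc).

(** Induction on the colours: K splits into its part of colour d and the rest. [Phi] sees only
    whether the first part is empty, and the nonempty subsets of a class of n elements contribute (1
    + x)^n - 1. [acc] holds the colours already taken as present. *)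
Lemma sum_coloured_subsets B (Phi : (T -> bool) -> A) L acc :
  uniq L -> (forall i, i \in B -> col i \in L) ->
  \sum_(K : {set I} | K \subset B)
    Phi (fun d => (d \in acc) || [exists i in K, col i == d]) * x ^+ #|K| =
  weighted_sum (fun d => (1 + x) ^+ #|[set i in B | col i == d]%SET| - 1) Phi L acc.
Proof.
elim: L B acc => [|d L IHL] B acc /=.
  move=> _ B0; have -> : B = finset.set0.
    by apply/setP => i; rewrite inE; apply/negP => /B0.
  rewrite (eq_bigl (pred1 finset.set0)) => [|K]; last by rewrite finset.subset0.
  rewrite big_pred1_eq cards0 mulr1; congr Phi; apply/funext => d.
  by rewrite (_ : [exists i in _, _] = false) ?orbF //; apply/existsP => -[i]; rewrite inE.
move=> /andP[dL uL] BL; set C := [set i | col i == d]%SET.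
rewrite (sum_subset_split _ C).
have BCE : [set i in B | col i == d]%SET = B :&: C by apply/setP => i; rewrite !inE.
have IH acc' : weighted_sum
    (fun d0 => (1 + x) ^+ #|[set i in B | col i == d0]%SET| - 1) Phi L acc' =
  \sum_(K : {set I} | K \subset B :\: C)
    Phi (fun d => (d \in acc') || [exists i in K, col i == d]) * x ^+ #|K|.
  rewrite IHL //; last first.
    move=> i; rewrite !inE => /andP[id iB].
    by have := BL i iB; rewrite inE (negbTE id).
  (* The induction hypothesis counts inside B minus C; for colours other than d the counts are those
     in B. *)
  have : forall d0, d0 \in L -> #|[set i in B | col i == d0]%SET| =
                                #|[set i in B :\: C | col i == d0]%SET|.
    move=> d0 d0L; congr #|pred_of_set _|; apply/setP => i; rewrite !inE.
    case: eqP => [->|]; last by rewrite !andbF.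
    by case: eqP => // e; rewrite -e d0L in dL.
  elim: L acc' {IHL dL uL BL} => //= d1 L IHL acc' eqL.
  by rewrite eqL ?mem_head // !IHL // => d2 d2L; apply: eqL; rewrite inE d2L orbT.
rewrite !IH (bigD1 finset.set0) ?finset.sub0set //=; congr (_ + _).
  by apply: eq_bigr => K _; rewrite finset.set0U.
rewrite BCE -sum_subset_pow [in RHS](bigD1 finset.set0) ?finset.sub0set //=.
rewrite cards0 expr0 [1 + _]addrC addrK mulr_suml; apply: eq_bigr => K1 /andP[K1s K1n0].
rewrite mulr_sumr; apply: eq_bigr => K2 K2s.
have [i iK1] := set0Pn _ K1n0.
have K1C j : j \in K1 -> col j = d.
  by move=> /(fintype.subsetP K1s); rewrite !inE => /andP[_ /eqP].
have dis : [disjoint K1 & K2].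
  apply/pred0P => j /=; apply/negP => /andP[/K1C jd /(fintype.subsetP K2s)].
  by rewrite !inE jd eqxx.
rewrite cardsU (_ : K1 :&: K2 = finset.set0) ?cards0 ?subn0; last first.
  by apply/eqP; rewrite setI_eq0.
rewrite exprD mulrCA; congr (_ * (Phi _ * _)); apply/funext => d0.
rewrite inE; case: (d0 \in acc); rewrite ?orbT //= orbF.
apply/existsP/orP => [[j]|[/eqP ->|/existsP[j /andP[jK jd]]]].
- rewrite !inE => /andP[/orP[/K1C ->|jK2]] /eqP <-; first by left.
  by right; apply/existsP; exists j; rewrite jK2 eqxx.
- by exists i; rewrite !inE iK1 K1C /=.
- by exists j; rewrite !inE jK orbT.
Qed.

End ColouredSubsetSums.

(** * Digraphs on three vertices and their weights *)

Definition v0 : 'I_3 := @Ordinal 3 0 isT.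
Definition v1 : 'I_3 := @Ordinal 3 1 isT.
Definition v2 : 'I_3 := @Ordinal 3 2 isT.

Lemma ord3P (v : 'I_3) : [\/ v = v0, v = v1 | v = v2].
Proof.
by case: v => -[|[|[|//]]] lt_v3;
  [constructor 1 | constructor 2 | constructor 3]; apply: val_inj.
Qed.

Definition arcs : seq ('I_3 * 'I_3) :=
  [:: (v0, v1); (v1, v0); (v0, v2); (v2, v0); (v1, v2); (v2, v1)].

Lemma arcsP (d : 'I_3 * 'I_3) : (d \in arcs) = (d.1 != d.2).
Proof. by case: d => a b; case: (ord3P a) => ->; case: (ord3P b) => ->. Qed.

Lemma arcs_uniq : uniq arcs. Proof. by []. Qed.

Section Digraph.
Implicit Types (P : 'I_3 * 'I_3 -> bool).

(** With c the third vertex, the disjuncts are the directed cycles of length 2 and 3 through the arc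
    (a, b). *)
Definition arc_in_cycle P a b c := P (a, b) ==> P (b, a) || P (b, c) && P (c, a).

Definition balanced P :=
  [&& arc_in_cycle P v0 v1 v2, arc_in_cycle P v1 v0 v2, arc_in_cycle P v0 v2 v1,
      arc_in_cycle P v2 v0 v1, arc_in_cycle P v1 v2 v0 & arc_in_cycle P v2 v1 v0].

Definition digon P a b := P (a, b) && P (b, a).

(* Strong connectedness, through the minimal strongly connected digraphs. *)
Definition strong P :=
  [|| [&& P (v0, v1), P (v1, v2) & P (v2, v0)],
      [&& P (v1, v0), P (v2, v1) & P (v0, v2)],
      digon P v0 v1 && digon P v0 v2, digon P v0 v1 && digon P v1 v2
    | digon P v0 v2 && digon P v1 v2].

Definition adjacent P a b := P (a, b) || P (b, a).

(* 2 minus the rank of the roots of P, for balanced P. *)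
Definition corank P : nat :=
  if strong P then 0 else
  if [|| adjacent P v0 v1, adjacent P v0 v2 | adjacent P v1 v2] then 1 else 2.

Definition parallel (d d' : 'I_3 * 'I_3) := (d' == d) || (d' == (d.2, d.1)).

Ltac case_digraph P :=
  case: (P (v0, v1)); case: (P (v1, v0)); case: (P (v0, v2));
  case: (P (v2, v0)); case: (P (v1, v2)); case: (P (v2, v1)).

Lemma strong_balanced P : strong P -> balanced P.
Proof. by rewrite /strong /balanced /digon /arc_in_cycle; case_digraph P. Qed.

Lemma strongS P P' : (forall d, P d -> P' d) -> strong P -> strong P'.
Proof.
move=> PP'; rewrite /strong /digon.
by case/or4P => [/and3P[]|/and3P[]|/andP[/andP[] + + /andP[]]|
  /orP[]/andP[/andP[] + + /andP[]]]; do ?move=> /PP' ->; rewrite ?orbT.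
Qed.

(** Two such arcs have independent roots, which gives a basis inside a strong support. *)
Lemma strong_not_parallel P : strong P ->
  exists d d', [/\ P d, P d' & ~~ parallel d d'].
Proof.
rewrite /strong /digon.
case/or4P => [/and3P[Pd Pd' _]|/and3P[Pd Pd' _]|/andP[/andP[Pd _] /andP[Pd' _]]|
  /orP[]/andP[/andP[Pd _] /andP[Pd' _]]]; by do 2!eexists; split; [exact: Pd | exact: Pd' |].
Qed.

(** Non-parallel arcs join two different pairs of vertices, so the underlying graph is connected;
    when every arc lies on a directed cycle, connected implies strongly connected. *)
Lemma balanced_strong P d d' : balanced P -> d \in arcs -> d' \in arcs ->
  P d -> P d' -> ~~ parallel d d' -> strong P.
Proof.
move=> Pb da da' Pd Pd' dd'.
have : [|| adjacent P v0 v1 && adjacent P v0 v2, adjacent P v0 v1 && adjacent P v1 v2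
         | adjacent P v0 v2 && adjacent P v1 v2].
  move: da da' Pd Pd' dd'; rewrite !inE /adjacent.
  by do 5?[case/orP]; move/eqP=> ->; do 5?[case/orP]; move/eqP=> -> // -> ->; rewrite ?orbT.
move: Pb {Pd Pd'}.
by rewrite /balanced /strong /digon /arc_in_cycle /adjacent; case_digraph P.
Qed.

(* The weight is g * (t - 1) ^ corank for the corresponding face, the value q c
   being that of the digon avoiding the vertex c; 0 when there is no face. *)
Section Weight.
Variables (A : comRingType) (q : 'I_3 -> A).

Definition weight P : A :=
  if strong P then 1 else
  if balanced P then
    if adjacent P v1 v2 then q v0 else
    if adjacent P v0 v2 then q v1 else
    if adjacent P v0 v1 then q v2 else 0
  else 0.

Lemma weight_unbalanced P : ~~ balanced P -> weight P = 0.
Proof.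
rewrite /weight; case: ifP => [/strong_balanced -> //|_].
by case: ifP.
Qed.

Variable y : 'I_3 * 'I_3 -> A.
Let w d := y d - 1.

(** Only the boolean conditions are computed, so the ring elements stay symbolic for [ring]. *)
Ltac eval_weights :=
  rewrite /weighted_sum /arcs /weight; repeat
  match goal with |- context [if ?b then _ else _] =>
    let v := eval vm_compute in b in change b with v; cbv iota end.

(** The sum unfolds into one term for each of the 64 sets of arcs, leaving a polynomial identity in
    three values of y. *)
Lemma weighted_sum_empty :
    y (v1, v0) = y (v0, v1) -> y (v2, v0) = y (v0, v2) -> y (v2, v1) = y (v1, v2) ->
    q v0 = y (v0, v1) * y (v0, v2) - 1 -> q v1 = y (v0, v1) * y (v1, v2) - 1 ->
    q v2 = y (v0, v2) * y (v1, v2) - 1 ->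
  weighted_sum w weight arcs [::] = q v0 * q v1 * q v2.
Proof.
move=> y10 y20 y21 q0 q1 q2; eval_weights.
rewrite /w y10 y20 y21 q0 q1 q2; ring.
Qed.

(** The arcs of the digon are already present and only contribute the factors 1 + w = y. Among the
    other four arcs, a set is strong if it both enters and leaves c, has weight q c if empty, and is
    unbalanced otherwise: the total is q c + (q c)^2 = (1 + q c) q c. *)
Lemma weighted_sum_digon a b c : uniq [:: a; b; c] ->
    y (a, c) = y (c, a) -> y (b, c) = y (c, b) -> q c = y (c, a) * y (c, b) - 1 ->
  weighted_sum w weight arcs [:: (a, b); (b, a)] =
  y (a, b) * y (b, a) * (y (c, a) * y (c, b)) * q c.
Proof.
case: (ord3P a) => ->; case: (ord3P b) => ->; case: (ord3P c) => -> // _ yac ybc qc;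
  eval_weights; rewrite /w qc ?yac ?ybc; ring.
Qed.

Lemma weight_digon a b c : uniq [:: a; b; c] ->
  weight (fun d => d \in [:: (a, b); (b, a)]) = q c.
Proof. by case: (ord3P a) => ->; case: (ord3P b) => ->; case: (ord3P c) => ->. Qed.

End Weight.

Lemma corank_digon a b : a != b -> corank (fun d => d \in [:: (a, b); (b, a)]) = 1%N.
Proof. by case: (ord3P a) => ->; case: (ord3P b) => ->. Qed.

(** An arc not parallel to (a, b) would make P strong. Hence no path returns from b to a through the
    third vertex, and balance forces the arc (b, a). *)
Lemma balanced_digon P a b : balanced P -> ~~ strong P -> a != b -> P (a, b) ->
  forall d, d \in arcs -> P d = (d \in [:: (a, b); (b, a)]).
Proof.
move=> Pb Ps ab Pab d da; rewrite !inE -[_ || _]/(parallel (a, b) d).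
have aba : (a, b) \in arcs by rewrite arcsP.
apply/idP/idP => [Pd|].
  by apply: contraNT Ps => /(balanced_strong Pb aba da Pab Pd).
case/orP=> /eqP -> //=.
move: Pb Ps Pab ab; rewrite /balanced /strong /digon /arc_in_cycle.
by case: (ord3P a) => ->; case: (ord3P b) => -> //; case_digraph P.
Qed.

End Digraph.

(** * Linear dependence of roots *)

Section RootCoordinates.
Variable R : realFieldType.
Implicit Types d : 'I_3 * 'I_3.

Definition root_coord d v : R := (v == d.1)%:R - (v == d.2)%:R.

Lemma typeA_rootE d v : typeA_root R d.1 d.2 0 v = root_coord d v.
Proof. by rewrite !mxE !eqxx. Qed.

Lemma root_coord_sum d : root_coord d v2 = - root_coord d v0 - root_coord d v1.
Proof.
case: d => a b; rewrite /root_coord.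
by case: (ord3P a) => ->; case: (ord3P b) => -> /=; rewrite ?subrr; ring.
Qed.

(** Two coordinates suffice because the three sum to 0: this minor vanishes exactly when the roots
    are dependent. *)
Definition root_det d d' : R :=
  root_coord d v0 * root_coord d' v1 - root_coord d v1 * root_coord d' v0.

Lemma root_det_eq0 d d' : d \in arcs -> d' \in arcs ->
  (root_det d d' == 0) = parallel d d'.
Proof.
rewrite !inE /root_det /root_coord.
do 5?[case/orP]; move/eqP=> ->; do 5?[case/orP]; move/eqP=> -> /=;
  rewrite !(oppr0, addr0, add0r, subr0, mulr0, mul0r, mulr1, mul1r, mulrN, mulNr, opprK, subrr,
            oppr_eq0, oner_eq0, eqxx) //.
Qed.

Lemma typeA_root_cramer d d1 d2 : root_det d1 d2 != 0 ->
  typeA_root R d.1 d.2 =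
    (root_det d d2 / root_det d1 d2) *: typeA_root R d1.1 d1.2 +
    (root_det d1 d / root_det d1 d2) *: typeA_root R d2.1 d2.2.
Proof.
move=> det0; apply/rowP => v; rewrite [RHS]mxE ![X in _ = X + _]mxE ![X in _ = _ + X]mxE.
rewrite !typeA_rootE; move: det0; rewrite /root_det.
by case: (ord3P v) => -> det0; rewrite ?root_coord_sum; field.
Qed.

Lemma typeA_root_pair_free d1 d2 (x y : R) : root_det d1 d2 != 0 ->
  x *: typeA_root R d1.1 d1.2 + y *: typeA_root R d2.1 d2.2 = 0 -> x = 0 /\ y = 0.
Proof.
move=> det0 /rowP xy0.
have ev v : x * root_coord d1 v + y * root_coord d2 v = 0.
  by have := xy0 v; rewrite mxE ![X in X + _]mxE ![X in _ + X]mxE !typeA_rootE mxE.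
split; apply: (mulIf det0); rewrite mul0r.
  transitivity ((x * root_coord d1 v0 + y * root_coord d2 v0) * root_coord d2 v1 -
    (x * root_coord d1 v1 + y * root_coord d2 v1) * root_coord d2 v0).
    by rewrite /root_det; ring.
  by rewrite !ev; ring.
transitivity ((x * root_coord d1 v1 + y * root_coord d2 v1) * root_coord d1 v0 -
    (x * root_coord d1 v0 + y * root_coord d2 v0) * root_coord d1 v1).
  by rewrite /root_det; ring.
by rewrite !ev; ring.
Qed.

End RootCoordinates.

(** * Positive relations among roots as circulations *)

Section TypeA.
Variables (R : realFieldType) (s : seq 'rV[R]_3) (dir : 'I_(size s) -> 'I_3 * 'I_3).
Hypothesis s_dir : forall i : 'I_(size s), s`_i = typeA_root R (dir i).1 (dir i).2.
Hypothesis dir_arc : forall i, dir i \in arcs.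
Implicit Types (J : {set 'I_(size s)}) (m : 'rV[R]_(size s)).

Definition arcs_of J d := [exists i in J, dir i == d].

Lemma arcs_ofP J d : reflect (exists2 i, i \in J & dir i = d) (arcs_of J d).
Proof.
apply: (iffP existsP) => [[i /andP[iJ /eqP di]]|[i iJ di]]; exists i => //.
by rewrite iJ di eqxx.
Qed.

Lemma arcs_of_dir J i : i \in J -> arcs_of J (dir i).
Proof. by move=> iJ; apply/arcs_ofP; exists i. Qed.

(** This is Kirchhoff's law, read off coordinate v of the relation: index i carries m_i along its
    arc. *)
Lemma relation_flow m v : m \in relation_space s ->
  \sum_(i | (dir i).1 == v) m 0 i = \sum_(i | (dir i).2 == v) m 0 i.
Proof.
rewrite mem_relation_space => /eqP/matrixP/(_ 0 v); rewrite summxE mxE => e.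
apply/eqP; rewrite -subr_eq0; apply/eqP; rewrite -[RHS]e.
rewrite [X in X - _]big_mkcond [X in _ - X]big_mkcond -sumrB /=.
apply: eq_bigr => i _; rewrite mxE s_dir typeA_rootE /root_coord mulrBr.
rewrite ![v == _]eq_sym.
by do 2!case: (_ == v); rewrite ?mulr1 ?mulr0.
Qed.

(** A positive amount enters the head of the arc of i, so by conservation some arc of J leaves
    it. *)
Lemma positive_relation_out J m i : positive_relation J m -> i \in J ->
  exists2 j, j \in J & (dir j).1 = (dir i).2.
Proof.
move=> [ms m0 mJ] iJ; apply: contrapT => no.
have : \sum_(j | (dir j).2 == (dir i).2) m 0 j = 0.
  rewrite -relation_flow // big1 // => j /eqP dj; apply/eqP; apply: contraT.
  by rewrite mJ => jJ; case: no; exists j.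
move/eqP; rewrite psumr_eq0 // => /allP/(_ i); rewrite mem_index_enum eqxx => /(_ isT).
by apply/negP; rewrite mJ.
Qed.

Lemma positive_relation_in J m i : positive_relation J m -> i \in J ->
  exists2 j, j \in J & (dir j).2 = (dir i).1.
Proof.
move=> [ms m0 mJ] iJ; apply: contrapT => no.
have : \sum_(j | (dir j).1 == (dir i).1) m 0 j = 0.
  rewrite relation_flow // big1 // => j /eqP dj; apply/eqP; apply: contraT.
  by rewrite mJ => jJ; case: no; exists j.
move/eqP; rewrite psumr_eq0 // => /allP/(_ i); rewrite mem_index_enum eqxx => /(_ isT).
by apply/negP; rewrite mJ.
Qed.

(** Some arc of J leaves b and some arc of J enters a. Unless one of them is (b, a), they are (b, c)
    and (c, a). *)
Lemma positive_support_arc J a b c : positive_support J -> uniq [:: a; b; c] ->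
  arc_in_cycle (arcs_of J) a b c.
Proof.
move=> [m pm] abc; apply/implyP => /arcs_ofP[i iJ di].
have third x : [\/ x = a, x = b | x = c].
  move: abc; case: (ord3P a) => ->; case: (ord3P b) => ->; case: (ord3P c) => -> // _;
  by case: (ord3P x) => ->; by [constructor 1 | constructor 2 | constructor 3].
have [j jJ j1] := positive_relation_out pm iJ.
have [k kJ k2] := positive_relation_in pm iJ.
have dj : dir j = (b, (dir j).2) by rewrite [LHS]surjective_pairing j1 di.
have dk : dir k = ((dir k).1, a) by rewrite [LHS]surjective_pairing k2 di.
have := dir_arc j; have := dir_arc k; rewrite !arcsP k2 j1 di /= => na nb.
have := arcs_of_dir jJ; rewrite dj; have := arcs_of_dir kJ; rewrite dk.
case: (third (dir j).2) nb => -> nb; rewrite ?eqxx // in nb *; first by move=> _ ->.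
case: (third (dir k).1) na => -> na; rewrite ?eqxx // in na *; first by move=> ->.
by move=> -> ->; rewrite orbT.
Qed.

Lemma cycle_relation (l : seq 'I_(size s)) : \sum_(j <- l) s`_j = 0 ->
  \row_j (count_mem j l)%:R \in relation_space s.
Proof.
move=> l0; rewrite mem_relation_space; apply/eqP; rewrite -[RHS]l0.
under eq_bigr do rewrite mxE scaler_nat.
elim: l {l0} => [|j l IHl]; first by rewrite big_nil big1.
rewrite big_cons -IHl /=; under eq_bigr do rewrite mulrnDr.
rewrite big_split /= (bigD1 j) //= eqxx mulr1n big1 ?addr0 // => i /negbTE ij.
by rewrite eq_sym ij.
Qed.

(** For the converse, pick for each index of J a directed cycle through it inside J; the sum of the
    cycle relations is nonnegative with support exactly J. *)
Lemma positive_supportP J : positive_support J <-> balanced (arcs_of J).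
Proof.
split=> [pJ|bal]; first by rewrite /balanced !positive_support_arc.
have cyc i : i \in J -> exists l, [/\ {subset l <= J}, i \in l & \sum_(j <- l) s`_j = 0].
  move=> iJ.
  have through a b c : dir i = (a, b) -> arc_in_cycle (arcs_of J) a b c ->
    exists l, [/\ {subset l <= J}, i \in l & \sum_(j <- l) s`_j = 0].
    move=> di /implyP; rewrite -di => /(_ (arcs_of_dir iJ)).
    case/orP => [/arcs_ofP[j jJ dj]|/andP[/arcs_ofP[j jJ dj] /arcs_ofP[k kJ dk]]].
      exists [:: i; j]; split; [|exact: mem_head|].
        by move=> x; rewrite !inE => /orP[]/eqP ->.
      by rewrite !big_cons big_nil !s_dir di dj /typeA_root /=; apply/rowP => v; rewrite !mxE; ring.
    exists [:: i; j; k]; split; [|exact: mem_head|].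
      by move=> x; rewrite !inE => /or3P[]/eqP ->.
    rewrite !big_cons big_nil !s_dir di dj dk /typeA_root /=.
    by apply/rowP => v; rewrite !mxE; ring.
  have /and5P[c1 c2 c3 c4 /andP[c5 c6]] := bal.
  have := dir_arc i; rewrite !inE.
  do 5?[case/orP]; move/eqP => di; by [apply: (through _ _ _ di c1) |
    apply: (through _ _ _ di c2) | apply: (through _ _ _ di c3) |
    apply: (through _ _ _ di c4) | apply: (through _ _ _ di c5) |
    apply: (through _ _ _ di c6)].
have /choice[l lP] : forall i, exists l, i \in J ->
    [/\ {subset l <= J}, i \in l & \sum_(j <- l) s`_j = 0].
  by move=> i; have [/cyc[l lP]|_] := boolP (i \in J); [exists l | exists [::]].
exists (\sum_(i in J) \row_j (count_mem j (l i))%:R); split.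
- by apply: memv_suml => i /lP[_ _]; apply: cycle_relation.
- by move=> j; rewrite summxE sumr_ge0 // => i _; rewrite mxE.
- move=> j; rewrite summxE; have [jJ|jJ] := boolP (j \in J).
    have [_ jl _] := lP j jJ.
    rewrite gt_eqF // (bigD1 j) //= ltr_wpDr ?mxE //.
      by apply: sumr_ge0 => i _; rewrite mxE.
    by rewrite ltr0n -has_count has_pred1.
  apply/negbTE; rewrite negbK big1 // => i iJ.
  have [lJ _ _] := lP i iJ; rewrite mxE.
  by rewrite (count_memPn _) // (contra (lJ j)).
Qed.

(** * Dimensions of the faces in type A *)

Variable r : 'I_3 -> 'I_3 -> nat.
Hypothesis r_gt0 : forall a b, a != b -> (0 < r a b)%N.
Hypothesis r_sym : forall a b, r b a = r a b.
Hypothesis card_dir : forall a b, a != b -> #|[set i | dir i == (a, b)]%SET| = r a b.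

(** Opposite roots occur equally often and cancel. *)
Lemma typeA_roots_sum0 : \sum_(i < size s) s`_i = 0.
Proof.
under eq_bigr do rewrite s_dir.
transitivity (\sum_(i in [set: 'I_(size s)]%SET) typeA_root R (dir i).1 (dir i).2).
  by apply: eq_bigl => i; rewrite inE.
rewrite (sum_by_colour (fun d => typeA_root R d.1 d.2) arcs_uniq) //.
have cE d : #|[set i in [set: 'I_(size s)]%SET | dir i == d]%SET| =
            #|[set i | dir i == d]%SET|.
  by apply: eq_card => i; rewrite !inE.
rewrite /arcs !big_cons big_nil !cE !card_dir //= !(r_sym v0, r_sym v1 v2) /typeA_root.
by apply/rowP => v; rewrite !(mxE, mulmxnE); ring.
Qed.

Lemma ex_dir a b : a != b -> exists i, dir i = (a, b).
Proof.
move=> ab; have := r_gt0 ab; rewrite -card_dir // => /card_gt0P[i].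
by rewrite inE => /eqP; exists i.
Qed.

(** This is [pdim_gale_face] for B = {i, j} with coefficients from Cramer's rule; the last two
    hypotheses make the coefficients of roots of J vanish at a basis element outside J. *)
Lemma pdim_pair J i j : root_det R (dir i) (dir j) != 0 ->
    (j \notin J -> forall k, k \in J -> root_det R (dir i) (dir k) = 0) ->
    (i \notin J -> forall k, k \in J -> root_det R (dir k) (dir j) = 0) ->
  pdim (gale_face J) = (size s)%:Z - #|J :|: [set i; j]%SET|%:Z - 1.
Proof.
move=> det0 Jj Ji.
have ij : i != j by apply: contraNneq det0 => ->; rewrite /root_det mulrC subrr.
have pair_sum (V : nmodType) (f : 'I_(size s) -> V) :
  \sum_(b in [set i; j]%SET) f b = f i + f j by rewrite big_setU1 ?inE //= big_set1.
apply: (@pdim_gale_face _ _ _ typeA_roots_sum0 J [set i; j]%SET (fun k b =>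
  (if b == i then root_det R (dir k) (dir j) else root_det R (dir i) (dir k)) /
  root_det R (dir i) (dir j))).
- move=> k; rewrite pair_sum eqxx eq_sym (negbTE ij) !s_dir.
  exact: typeA_root_cramer.
- move=> c; rewrite pair_sum !s_dir => /(typeA_root_pair_free det0)[ci cj] b.
  by rewrite !inE => /orP[]/eqP ->.
- move=> k b kJ; rewrite !inE => /orP[]/eqP -> bJ.
    by rewrite eqxx Ji // mul0r.
  by rewrite eq_sym (negbTE ij) Jj // mul0r.
Qed.

Lemma arcs_of_digon J i : balanced (arcs_of J) -> ~~ strong (arcs_of J) -> i \in J ->
  arcs_of J = (fun d => d \in [:: ((dir i).1, (dir i).2); ((dir i).2, (dir i).1)]).
Proof.
move=> Jb Js iJ; apply/funext => d; have := dir_arc i; rewrite arcsP => ai.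
have Pi : arcs_of J ((dir i).1, (dir i).2) by rewrite -surjective_pairing arcs_of_dir.
have [da|da] := boolP (d \in arcs); first exact: balanced_digon.
have -> : arcs_of J d = false.
  by apply/negbTE/negP => /arcs_ofP[k _ dk]; rewrite -dk dir_arc in da.
by apply/esym/negbTE; apply: contra da; rewrite arcsP !inE => /orP[]/eqP -> //=; rewrite eq_sym.
Qed.

(** The basis pair has as many members in J as the rank allows: two if J is strong, one for a digon,
    none if J is empty. It thus adds exactly [corank] indices to J. *)
Lemma pdim_corank J : balanced (arcs_of J) ->
  pdim (gale_face J) = (size s)%:Z - #|J|%:Z - 1 - (corank (arcs_of J))%:Z.
Proof.
move=> Jb.
have det_par i k : (root_det R (dir i) (dir k) == 0) = parallel (dir i) (dir k).
  exact: root_det_eq0.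
have [Js|Js] := boolP (strong (arcs_of J)).
  have [d [d' [/arcs_ofP[i iJ <-] /arcs_ofP[j jJ <-] nij]]] := strong_not_parallel Js.
  rewrite (@pdim_pair J i j) ?det_par ?iJ ?jJ // /corank Js subr0.
  by rewrite (finset.setUidPl _) // finset.subUset !finset.sub1set iJ jJ.
have [->|[i iJ]] := set_0Vmem J.
  have [i di] := ex_dir (isT : v0 != v1); have [j dj] := ex_dir (isT : v0 != v2).
  have ij : i != j by apply/eqP => ij; move: di; rewrite ij dj.
  rewrite (@pdim_pair _ i j) ?det_par ?di ?dj //; try by move=> _ k; rewrite inE.
  rewrite finset.set0U cards2 ij cards0.
  have -> : arcs_of finset.set0 = (fun d => d \in [::]).
    by apply/funext => d; apply/negbTE/negP => /arcs_ofP[k]; rewrite inE.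
  by rewrite -[corank _]/2%N /=; lia.
have [j nij] : exists j, ~~ parallel (dir i) (dir j).
  suff [d da nd] : exists2 d, d.1 != d.2 & ~~ parallel (dir i) d.
    by have [j dj] := ex_dir da; exists j; rewrite dj -surjective_pairing.
  have := dir_arc i; rewrite !inE; do 5?[case/orP]; move/eqP=> ->;
    by [exists (v0, v1) | exists (v0, v2)].
have par k : k \in J -> parallel (dir i) (dir k).
  move=> kJ; apply: contraNT Js; apply: balanced_strong => //; exact: arcs_of_dir.
have jJ : j \notin J by apply: contra nij; exact: par.
rewrite (@pdim_pair _ i j) ?det_par ?iJ //; last first.
  by move=> _ k /par kp; apply/eqP; rewrite det_par.
have -> : J :|: [set i; j]%SET = j |: J.
  apply/setP => k; rewrite !inE; case: eqP => [->|_]; rewrite ?iJ ?orbT //=.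
  by rewrite orbC.
rewrite cardsU1 jJ (arcs_of_digon Jb Js iJ) corank_digon; first lia.
by rewrite -arcsP.
Qed.

(** * The recursion for h and g in type A *)

Definition valence c := (\sum_(j < 3 | j != c) r c j)%N.

(** A digon avoiding c has corank 1 and g = [p] with p = [valence c], whence [p] (t - 1) = t^p -
    1. *)
Definition line_weight c : {poly int} := 'X^(valence c) - 1.

Lemma arcs_ofU J K : arcs_of (J :|: K) = (fun d => arcs_of J d || arcs_of K d).
Proof.
apply/funext => d; apply/arcs_ofP/orP => [[i]|[]/arcs_ofP[i iJ di]].
- by rewrite inE => /orP[] iJ di; [left|right]; apply/arcs_ofP; exists i.
- by exists i; rewrite // inE iJ.
- by exists i; rewrite // inE iJ orbT.
Qed.

(** For J' = J + K, the exponent in the recursion is |K| + corank J' - corank J - 1. Multiplying by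
    (t - 1)^(corank J + 1) leaves |K| + corank J', and the second summand turns g into the weight.
    The added weight of J is the term K = 0, and unbalanced sets contribute 0. *)
Lemma h_poly_corank J : balanced (arcs_of J) -> J != [set: 'I_(size s)]%SET ->
    (forall J', J \proper J' -> balanced (arcs_of J') ->
      g_poly (gale_face J') * ('X - 1) ^+ corank (arcs_of J') =
      weight line_weight (arcs_of J')) ->
  h_poly (gale_face J) * ('X - 1) ^+ (corank (arcs_of J)).+1
    + weight line_weight (arcs_of J) =
  \sum_(K : {set 'I_(size s)} | K \subset ~: J)
    weight line_weight (arcs_of (J :|: K)) * ('X - 1) ^+ #|K|.
Proof.
move=> Jb JT gE; have pJ : positive_support J by apply/positive_supportP.
rewrite (h_poly_gale_face typeA_roots_sum0 pJ JT) mulr_suml.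
rewrite [RHS](bigD1 finset.set0) ?finset.sub0set //= finset.setU0 cards0 mulr1.
rewrite [RHS]addrC; congr (_ + _).
rewrite (reindex_onto (fun K => J :|: K) (fun J' => J' :\: J)) /=; last first.
  move=> J' /andP[_ /fintype.proper_sub JJ'].
  by rewrite -[RHS](finset.setID _ J) (finset.setIidPr JJ').
rewrite [LHS]big_mkcond [RHS]big_mkcond /=; apply: eq_bigr => K _.
have -> : [&& `[< positive_support (J :|: K) >] && (J \proper J :|: K)
           & (J :|: K) :\: J == K] =
          balanced (arcs_of (J :|: K)) && ((K \subset ~: J) && (K != finset.set0)).
  rewrite -andbA; congr (_ && _).
    by apply/asboolP/idP => /positive_supportP.
  rewrite finset.setDUl finset.setDv finset.set0U.
  have -> : (K :\: J == K) = (K \subset ~: J).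
    by rewrite finset.setDE; apply/eqP/finset.setIidPl.
  rewrite andbC; case: (boolP (K \subset ~: J)) => //= KJ.
  rewrite fintype.properE finset.subsetUl finset.subUset fintype.subxx /=.
  congr negb; apply/idP/eqP => [KJ'|->]; last exact: finset.sub0set.
  apply/eqP; rewrite -finset.subset0 -(finset.setICr J) finset.subsetI KJ' KJ //.
have [JKb|/weight_unbalanced ->] := boolP (balanced _); last by rewrite mul0r if_same.
rewrite /=; case: ifP => // /andP[KJ K0].
have cK : #|J :|: K| = (#|J| + #|K|)%N.
  have JK : [disjoint J & K] by rewrite disjoint_sym finset.disjoints_subset.
  by rewrite cardsU (finset.disjoint_setI0 JK) cards0 subn0.
have JJK : J \proper J :|: K.
  rewrite fintype.properE finset.subsetUl; apply: contra K0 => JKJ.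
  by rewrite -cards_eq0 -(eqn_add2l #|J|) -cK addn0 eqn_leq !subset_leq_card ?finset.subsetUl.
have pJK : positive_support (J :|: K) by apply/positive_supportP.
(* The strict drop in dimension makes the argument of [absz] nonnegative, so the exponents add as
   integers. *)
have /pdim_proper_face : proper_faces (gale_face J) (gale_face (J :|: K)).
  split; first by apply/(face_of_gale_face typeA_roots_sum0 _ pJ); exists (J :|: K);
    rewrite finset.subsetUl.
  by move=> /(gale_face_inj pJK pJ) e; move: JJK; rewrite e fintype.properxx.
rewrite -gE // (pdim_corank Jb) (pdim_corank JKb) cK => lt_dim.
rewrite -!mulrA -!exprD; congr (_ * _ ^+ _); move: lt_dim.
set a := corank _; set b := corank _; set c := #|J|; set d := #|K|; lia.
Qed.

(** Since 1 + (t - 1) = t, n copies of an arc outside J contribute t^n - 1. *)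
Lemma sum_weight J acc : (forall d, arcs_of J d = (d \in acc)) ->
  \sum_(K : {set 'I_(size s)} | K \subset ~: J)
    weight line_weight (arcs_of (J :|: K)) * ('X - 1) ^+ #|K| =
  weighted_sum (fun d => 'X^(#|[set i in ~: J | dir i == d]%SET|) - 1)
    (weight line_weight) arcs acc.
Proof.
move=> accE.
have X1 : 1 + ('X - 1) = 'X :> {poly int} by ring.
transitivity (weighted_sum (fun d => (1 + ('X - 1)) ^+ #|[set i in ~: J | dir i == d]%SET| - 1)
  (weight line_weight) arcs acc); last by rewrite X1.
rewrite -sum_coloured_subsets ?arcs_uniq //.
apply: eq_bigr => K _; congr (weight _ _ * _); rewrite arcs_ofU.
by apply/funext => d; rewrite accE.
Qed.

Lemma valenceE a b c : uniq [:: a; b; c] -> valence c = (r c a + r c b)%N.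
Proof.
move=> abc; have [ac bc ba] : [/\ a != c, b != c & b != a].
  by move: abc; case: (ord3P a) => ->; case: (ord3P b) => ->; case: (ord3P c) => ->.
rewrite /valence (bigD1 a) //= (bigD1 b) ?bc //=.
rewrite big1 ?addn0 // => x /andP[/andP[xc xa] xb].
move: abc xc xa xb; case: (ord3P a) => ->; case: (ord3P b) => ->; case: (ord3P c) => -> //;
  by case: (ord3P x) => ->.
Qed.

Lemma strong_setT : strong (arcs_of [set: 'I_(size s)]%SET).
Proof.
have arcT a b : a != b -> arcs_of [set: 'I_(size s)]%SET (a, b).
  by move=> /ex_dir[i di]; apply/arcs_ofP; exists i.
by rewrite /strong !arcT.
Qed.

(** Induction on the size of the complement of J, as the recursion involves only larger supports. J
    is either strong or a digon, and the sum over K is evaluated in each case. *)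
Lemma g_poly_corank J : balanced (arcs_of J) -> J != finset.set0 ->
  g_poly (gale_face J) * ('X - 1) ^+ corank (arcs_of J) =
  weight line_weight (arcs_of J).
Proof.
have dimE (n m z p : nat) : (0 < p)%N -> (m + (z + p + p) = n)%N ->
  (absz (n%:Z - m%:Z - 1 - 1)%R).+2 = (z + p + p)%N by lia.
have [k] := ubnP #|~: J|; elim: k J => // k IHk J; rewrite ltnS => Jk Jb J0.
have [JT|JT] := eqVneq J [set: 'I_(size s)]%SET.
  by rewrite JT gale_face_setT g_poly_set0 /corank /weight strong_setT mulr1.
have gE J' : J \proper J' -> balanced (arcs_of J') ->
  g_poly (gale_face J') * ('X - 1) ^+ corank (arcs_of J') = weight line_weight (arcs_of J').
  move=> JJ' J'b; apply: IHk => //.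
    by apply: leq_trans Jk; apply: proper_card; rewrite finset.properC.
  apply: contra J0 => /eqP J'0; move: JJ'; rewrite J'0 => /fintype.proper_sub.
  by rewrite finset.subset0.
have := h_poly_corank Jb JT gE.
have cJ : (#|J| + #|~: J| = size s)%N by rewrite cardsC card_ord.
rewrite /g_poly; case: eqP => [/(gale_face_neq0 JT)//|_].
rewrite (pdim_corank Jb).
have [Js|Js] := boolP (strong (arcs_of J)).
  (* A support containing a strong one is strong, so all weights are 1 and the sum is t^(dim + 1),
     as for a simplex. *)
  rewrite {1 2 3}/corank {1 3}/weight Js expr1 mulr1.
  rewrite (eq_bigr (fun K : {set 'I_(size s)} => ('X - 1 : {poly int}) ^+ #|K|))
    => [|K _]; last first.
    rewrite /weight (strongS _ Js) ?mul1r // => d /arcs_ofP[i iJ di].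
    by apply/arcs_ofP; exists i; rewrite // inE iJ.
  rewrite sum_subset_pow [1 + _]addrC subrK => hE.
  apply: g_of_h_simplex; rewrite hE; congr ('X^_).
  have : (0 < #|~: J|)%N.
    by rewrite card_gt0; apply: contra JT => /eqP JC; rewrite -[J]finset.setCK JC finset.setC0.
  move: cJ; set a := #|J|; set b := #|~: J|; lia.
have [i iJ] := set0Pn _ J0.
move: (arcs_of_digon Jb Js iJ) (dir_arc i); rewrite arcsP.
move: (dir i).1 (dir i).2 => a b JE ab.
have [c abc] : exists c, uniq [:: a; b; c].
  move: ab; case: (ord3P a) => ->; case: (ord3P b) => -> // _;
    by [exists v0 | exists v1 | exists v2].
rewrite (sum_weight (acc := [:: (a, b); (b, a)])) ?JE // (weight_digon _ abc).
rewrite corank_digon // expr1.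
have cC x y : (x, y) \notin [:: (a, b); (b, a)] -> x != y ->
    #|[set i in ~: J | dir i == (x, y)]%SET| = r x y.
  move=> xyJ xy; rewrite -card_dir //; apply: eq_card => j; rewrite !inE.
  case: eqP => dj; rewrite ?andbF // andbT; apply: contraNN xyJ => jJ.
  by rewrite -dj; move: (arcs_of_dir jJ); rewrite JE.
have [ac bc] : a != c /\ b != c.
  by move: abc; rewrite /= !inE andbT negb_or -andbA => /and3P[].
have [nac nca nbc ncb] : [/\ (a, c) \notin [:: (a, b); (b, a)], (c, a) \notin [:: (a, b); (b, a)],
    (b, c) \notin [:: (a, b); (b, a)] & (c, b) \notin [:: (a, b); (b, a)]].
  by move: abc; case: (ord3P a) => ->; case: (ord3P b) => ->; case: (ord3P c) => ->.
have := weighted_sum_digon (q := line_weight)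
  (y := fun d => 'X^(#|[set i in ~: J | dir i == d]%SET|)) abc.
rewrite (cC _ _ nac) // (cC _ _ nca) 1?eq_sym // (cC _ _ nbc) // (cC _ _ ncb) 1?eq_sym //.
rewrite /line_weight (valenceE abc) !(r_sym a c, r_sym b c) -!exprD.
move=> /(_ erefl erefl erefl) ->.
(* [za] and [zb] count the copies of the two digon arcs outside J; with p arcs into c and p out of c
   they are all the generators of the face. *)
set p := (r a c + r b c)%N; set za := #|_|; set zb := #|_| => hE.
have p_gt0 : (0 < p)%N by rewrite /p addn_gt0 r_gt0.
have pL : perm_eq arcs [:: (a, b); (b, a); (a, c); (c, a); (b, c); (c, b)].
  by move: abc; case: (ord3P a) => ->; case: (ord3P b) => ->; case: (ord3P c) => ->.
have cJC : #|~: J| = (za + zb + p + p)%N.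
  rewrite -sum1_card (@sum_by_colour _ _ _ dir _ _ (fun=> 1%N) arcs_uniq) //.
  rewrite (perm_big _ pL) !big_cons big_nil !natn -/za -/zb.
  rewrite (cC _ _ nac) // (cC _ _ nca) 1?eq_sym // (cC _ _ nbc) // (cC _ _ ncb) 1?eq_sym //.
  rewrite -[LHS]/(za + (zb + (r a c + (r c a + (r b c + (r c b + 0))))))%N.
  by rewrite !(r_sym a c, r_sym b c) /p; ring.
rewrite geom_sumE mulrC; congr (_ * _).
apply: (@g_of_h_simplex_sum p (za + zb)); rewrite ?hE -?exprD //.
by apply: dimE => //; rewrite -cJC.
Qed.

(* The empty set of arcs contributes weight 0, so the recursion holds at J = 0
   without knowing g of the whole polytope. *)
Lemma h_poly_typeA :
  h_poly (gale_face (finset.set0 : {set 'I_(size s)})) =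
  \prod_(c < 3) geom_sum (valence c).
Proof.
have arcs0 : arcs_of finset.set0 = (fun d => d \in [::]).
  by apply/funext => d; apply/negbTE/negP => /arcs_ofP[k]; rewrite inE.
have b0 : balanced (arcs_of finset.set0) by rewrite arcs0.
have n0 : (finset.set0 : {set 'I_(size s)}) != [set: 'I_(size s)]%SET.
  have [i _] := ex_dir (isT : v0 != v1).
  by apply/eqP => /setP/(_ i); rewrite !inE.
have gE J' : finset.set0 \proper J' -> balanced (arcs_of J') ->
  g_poly (gale_face J') * ('X - 1) ^+ corank (arcs_of J') = weight line_weight (arcs_of J').
  rewrite fintype.properE finset.sub0set finset.subset0 => J'0 J'b.
  exact: g_poly_corank.
have := h_poly_corank b0 n0 gE; rewrite (@sum_weight _ [::]) => [|d]; last by rewrite arcs0.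
have w0 : weight line_weight (arcs_of finset.set0) = 0 by rewrite arcs0.
rewrite w0 addr0 arcs0 -[corank _]/2%N.
have cC x y : x != y ->
    #|[set i in ~: (finset.set0 : {set 'I_(size s)}) | dir i == (x, y)]%SET| = r x y.
  by move=> xy; rewrite -card_dir //; apply: eq_card => j; rewrite !inE.
pose y (d : 'I_3 * 'I_3) : {poly int} :=
  'X^(#|[set i in ~: (finset.set0 : {set 'I_(size s)}) | dir i == d]%SET|).
have yE a b : a != b -> y (a, b) = 'X^(r a b) by move=> ab; rewrite /y cC.
rewrite -[X in weighted_sum X]/(fun d => y d - 1) weighted_sum_empty ?yE //.
(* The exponent 3 is corank 2 plus 1 on the left, and one factor t - 1 from each t^(r_c) - 1 on the
   right. *)
- rewrite /line_weight !geom_sumE => hE; apply: (mulIf (expf_neq0 3 X1_neq0)).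
  rewrite hE !big_ord_recl big_ord0.
  have -> : ord0 = v0 by apply: val_inj.
  have -> : lift v0 ord0 = v1 by apply: val_inj.
  have -> : lift v0 (lift ord0 ord0) = v2 by apply: val_inj.
  by ring.
- by rewrite (r_sym v0).
- by rewrite (r_sym v0).
- by rewrite (r_sym v1).
- by rewrite /line_weight (@valenceE v1 v2) // exprD.
- by rewrite /line_weight (@valenceE v0 v2) // exprD r_sym.
- by rewrite /line_weight (@valenceE v0 v1) // exprD !(r_sym _ v2).
Qed.

End TypeA.

(** * The sequence of roots with multiplicities *)

Section RootSequence.
Variables (R : realFieldType) (r : 'I_3 -> 'I_3 -> nat).

(** Listed in the order of [typeA_roots], so that position i here labels the i-th root. *)
Definition root_arcs : seq ('I_3 * 'I_3) :=
  flatten [seq nseq (r d.1 d.2) d | d <- enum {: 'I_3 * 'I_3} & d.1 != d.2].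

Lemma typeA_roots_map :
  typeA_roots R r = [seq typeA_root R d.1 d.2 | d <- root_arcs].
Proof.
rewrite /typeA_roots /root_arcs map_flatten -map_comp; congr flatten.
by apply: eq_map => d /=; rewrite map_nseq.
Qed.

Lemma root_arcs_arc d : d \in root_arcs -> d \in arcs.
Proof.
move=> /flattenP[l /mapP[d']]; rewrite mem_filter => /andP[d'a _] ->.
by rewrite mem_nseq arcsP => /andP[_ /eqP ->].
Qed.

Lemma count_root_arcs d : d \in arcs -> count_mem d root_arcs = r d.1 d.2.
Proof.
rewrite arcsP => da; rewrite count_flatten -map_comp sumnE big_map.
rewrite (bigD1_seq d) /=; last first.
- by rewrite filter_uniq ?enum_uniq.
- by rewrite mem_filter da mem_enum.
rewrite count_nseq /= eqxx mul1n big1 ?addn0 // => d' d'd.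
by rewrite count_nseq /= (negbTE d'd).
Qed.

Lemma card_nth_eq (T : eqType) (x0 d : T) (l : seq T) n : n = size l ->
  #|[set i : 'I_n | nth x0 l i == d]%SET| = count_mem d l.
Proof.
move=> ->; rewrite -sum1_count (big_nth x0) big_mkord -sum1_card.
by apply: eq_bigl => i; rewrite inE.
Qed.

Lemma gale_root_polytopeE :
  gale_root_polytope R r = gale_face (finset.set0 : {set 'I_(size (typeA_roots R r))}).
Proof.
congr convex_hull; apply/seteqP; split=> x /=.
  by move=> [i _ <-]; exists i; rewrite ?inE.
by move=> [i _ ->]; exists i.
Qed.

End RootSequence.

Theorem lemma5p2 (R : realType) (r : 'I_3 -> 'I_3 -> nat)
    (r_gt0 : forall i j : 'I_3, i != j -> (0 < r i j)%N)
    (r_sym : forall i j : 'I_3, r j i = r i j) :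
  h_poly (gale_root_polytope R r) =
    \prod_(i < 3) \sum_(k < (\sum_(j < 3 | j != i) r i j)%N) 'X^k.
Proof.
(* The default (v0, v1) is never returned, since both lists have the same length. *)
pose dir (i : 'I_(size (typeA_roots R r))) := nth (v0, v1) (root_arcs r) i.
have sz : size (typeA_roots R r) = size (root_arcs r).
  by rewrite typeA_roots_map size_map.
have dir_arc i : dir i \in arcs.
  by apply: (@root_arcs_arc r); rewrite mem_nth // -sz.
rewrite gale_root_polytopeE; apply: (@h_poly_typeA _ _ dir) => //.
  move=> i; transitivity ([seq typeA_root R d.1 d.2 | d <- root_arcs r]`_i).
    by congr nth; exact: typeA_roots_map.
  by rewrite (nth_map (v0, v1)) // -sz.
by move=> a b ab; rewrite card_nth_eq // count_root_arcs // arcsP.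
Qed.
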